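(* Let $s\ge 2$ be an integer, let $\vec t=(t_1,t_2,\dots)$ be a sequence with $t_j\in[-1,1]$ for all $j\ge 1$, and let $k\ge 0$ be an integer. Then $$\zeta^{\vec t}(\{s\}_k)=\sum_{\ell=0}^{k}\zeta^{\star}\big(\{(\vec t,s)\}_\ell\big)\cdot\zeta\big(\{(\vec 1-\vec t,s)\}_{k-\ell}\big).$$ Moreover, $$\zeta^{\vec t}(\{s\}_k)=\frac1{k!}B_k(x_1,\dots,x_k),\qquad x_j=(j-1)!\Big(\zeta\big((\vec t^{\,j},js)\big)-\zeta\big(((\vec t-\vec 1)^j,js)\big)\Big),\quad 1\le j\le k,$$ where $B_k$ denotes the complete Bell polynomial.
   Context: For positive integers $i_1,\dots,i_k$ with $i_1\ge 2$ and a sequence $\vec t=(t_1,t_2,\dots)$ with $t_j\in[-1,1]$, the multi-interpolated multiple zeta value is $$\zeta^{\vec t}(i_1,\dots,i_k)=\sum_{\ell_1\ge\cdots\ge\ell_k\ge 1}\frac{\prod_{j=1}^\infty t_j^{\sigma_j(\ell_1,\dots,\ell_k)}}{\ell_1^{i_1}\cdots\ell_k^{i_k}},\qquad \sigma_j(\ell_1,\dots,\ell_k)=|\{1\le r\le k-1:\ \ell_r=\ell_{r+1}=j\}|,$$ with $t_j^0=1$. $\{a\}_k$ means $a$ repeated $k$ times, and $\zeta^{\vec t}(\{s\}_0)=1$. For a bounded real sequence $\vec u=(u_1,u_2,\dots)$ and an integer $k\ge1$, $$\zeta\big(\{(\vec u,s)\}_k\big)=\sum_{\ell_1>\cdots>\ell_k\ge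 1}\frac{u_{\ell_1}\cdots u_{\ell_k}}{\ell_1^{s}\cdots\ell_k^{s}},\qquad \zeta^\star\big(\{(\vec u,s)\}_k\big)=\sum_{\ell_1\ge\cdots\ge\ell_k\ge 1}\frac{u_{\ell_1}\cdots u_{\ell_k}}{\ell_1^{s}\cdots\ell_k^{s}},$$ and both equal $1$ for $k=0$. Here $\vec 1-\vec t=(1-t_1,1-t_2,\dots)$. For $j\ge1$, $$\zeta\big((\vec t^{\,j},js)\big)=\sum_{m\ge 1}\frac{t_m^j}{m^{js}},\qquad \zeta\big(((\vec t-\vec 1)^j,js)\big)=\sum_{m\ge 1}\frac{(t_m-1)^j}{m^{js}}.$$ The complete Bell polynomials $B_j(x_1,\dots,x_j)$ are determined by $\exp\big(\sum_{\ell\ge1}\frac{z^\ell}{\ell!}x_\ell\big)=\sum_{j\ge0}\frac{B_j(x_1,\dots,x_j)}{j!}z^j$ (so $B_0=1$). *)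

(* Defs.v *)
From mathcomp Require Import all_boot all_order all_algebra.
From mathcomp Require Import finmap.
From mathcomp Require Import all_classical all_reals all_analysis.
From mathcomp.analysis.showcase Require Import summability.
Set Implicit Arguments.
Unset Strict Implicit.
Unset Printing Implicit Defensive.
Import Order.TTheory GRing.Theory Num.Theory.
Import numFieldNormedType.Exports.
Local Open Scope classical_set_scope.
Local Open Scope ring_scope.

(* Sequences (t_1, t_2, ...) are functions on nat whose value at 0 is never
   used.  The multiple series below are absolutely convergent in the range of
   interest (bounded numerators, every exponent positive, the first at least 2),
   so they are taken as unordered sums: [summability.sum] is the limit of the
   finite partial sums along the directed set of finite sets of indices. *)

(* l_1 >= ... >= l_k >= 1 *)
Definition wdecr_index (k : nat) :=
  {l : k.-tuple nat | sorted geq l && all (leq 1) l}.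

(* l_1 > ... > l_k >= 1 *)
Definition sdecr_index (k : nat) :=
  {l : k.-tuple nat | sorted gtn l && all (leq 1) l}.

(* Positions are counted from 0 here; for k = 0 there is no r, as 0.-1 = 0. *)
Definition sigma (k : nat) (j : nat) (l : k.-tuple nat) : nat :=
  #|[pred r : 'I_k.-1 | (nth 0%N l r == nth 0%N l r.+1)
                        && (nth 0%N l r.+1 == j)]|.

Section MultipleZeta.
Variable R : realType.
Implicit Types t u : nat -> R.

(* The product over all j >= 1 has finitely many factors different from 1,
   since sigma j l = 0 (and x ^+ 0 = 1, even for x = 0) for j > l_1. *)
Definition interp_weight t (k : nat) (l : k.-tuple nat) : R :=
  \big[*%R/1]_(j \in [set j : nat | (1 <= j)%N]) t j ^+ sigma j l.

(* In depth k = 0, in this definition as in the next two, the only index is the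
   empty tuple, whose term is 1. *)
Definition interp_mzv t (k : nat) (i : k.-tuple nat) : R :=
  sum (fun l : wdecr_index k =>
    interp_weight t (val l)
      / \prod_(r < k) (tnth (val l) r)%:R ^+ tnth i r : R).

Definition mzv_rep u (s k : nat) : R :=
  sum (fun l : sdecr_index k =>
    (\prod_(r < k) u (tnth (val l) r))
      / \prod_(r < k) (tnth (val l) r)%:R ^+ s : R).

Definition mzsv_rep u (s k : nat) : R :=
  sum (fun l : wdecr_index k =>
    (\prod_(r < k) u (tnth (val l) r))
      / \prod_(r < k) (tnth (val l) r)%:R ^+ s : R).

Definition weighted_zeta u (a : nat) : R :=
  \big[+%R/0]_(1 <= m <oo) (u m / m%:R ^+ a).

End MultipleZeta.

Section CompleteBell.
Variable F : numFieldType.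
Implicit Type x : nat -> F.

Definition Bell_exponent x (N : nat) : {poly F} :=
  \sum_(1 <= l < N.+1) (x l / l`!%:R) *: 'X^l.

Definition exp_trunc (N : nat) (p : {poly F}) : {poly F} :=
  \sum_(n < N.+1) n`!%:R^-1 *: p ^+ n.

(* B_j(x_1, ..., x_j) is j! times the coefficient of z^j in the formal power
   series exp(\sum_(l >= 1) x_l z^l / l!).  The exponent has no constant term,
   so neither its terms of degree > j nor its powers of exponent > j contribute
   to that coefficient: see complete_BellE. *)
Definition complete_Bell (j : nat) x : F :=
  j`!%:R * (exp_trunc j (Bell_exponent x j))`_j.

Lemma complete_BellE x (N j : nat) : (j <= N)%N ->
  (exp_trunc N (Bell_exponent x N))`_j = complete_Bell j x / j`!%:R.
Proof.
move=> jN; have fact0 : j`!%:R != 0 :> F by rewrite pnatr_eq0 -lt0n fact_gt0.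
rewrite /complete_Bell mulrAC mulfV// mul1r.
have divX M : exists q, Bell_exponent x M = 'X * q.
  exists (\sum_(1 <= l < M.+1) (x l / l`!%:R) *: 'X^(l.-1)).
  rewrite mulr_sumr; apply: eq_big_nat => -[|l]// _.
  by rewrite -scalerAr -exprS.
have high M n : (j < n)%N -> (Bell_exponent x M ^+ n)`_j = 0.
  by move=> jn; have [q ->] := divX M; rewrite exprMn coefXnM jn.
have low n : (Bell_exponent x N ^+ n)`_j = (Bell_exponent x j ^+ n)`_j.
  apply/eqP; rewrite -subr_eq0 -coefB subrXX.
  have -> : Bell_exponent x N - Bell_exponent x j =
      'X^(j.+1) * \sum_(j.+1 <= l < N.+1) (x l / l`!%:R) *: 'X^(l - j.+1).
    rewrite /Bell_exponent (@big_cat_nat _ _ _ j.+1)//= addrAC subrr add0r mulr_sumr.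
    apply: eq_big_nat => l /andP[jl _].
    by rewrite -scalerAr -exprD subnKC.
  by rewrite -mulrA coefXnM ltnSn.
rewrite /exp_trunc !coef_sum.
under eq_bigr do rewrite coefZ low.
under [RHS]eq_bigr do rewrite coefZ.
rewrite -(big_mkord xpredT (fun n => n`!%:R^-1 * (Bell_exponent x j ^+ n)`_j)).
rewrite (@big_cat_nat _ _ _ j.+1)//= big_mkord.
rewrite [X in _ + X]big_nat [X in _ + X]big1 ?addr0// => n /andP[jn _].
by rewrite high// mulr0.
Qed.

End CompleteBell.

(* Main.v *)
Require Import Defs.
From mathcomp Require Import all_boot all_order all_algebra finmap.
From mathcomp Require Import all_classical all_reals all_analysis.
From mathcomp.analysis.showcase Require Import summability.
From mathcomp Require Import ring lra zify.
Set Implicit Arguments.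
Unset Strict Implicit.
Unset Printing Implicit Defensive.
Import Order.TTheory GRing.Theory Num.Theory.
Import numFieldNormedType.Exports.
Local Open Scope ring_scope.

(** The sum over indices with all entries at most [N] has generating function
    [prod_(m <= N) (1 + (1 - t_m) x_m z) / (1 - t_m x_m z)] with [x_m = m^-s]:
    an entry [m] repeated [n >= 1] times contributes [t_m^(n-1) (x_m z)^n], and
    [1 + sum_(n >= 1) t^(n-1) y^n = (1 + (1 - t) y) / (1 - t y)].  Its numerators
    and denominators generate the truncations of the two kinds of series in the
    product formula.  Its logarithmic derivative gives Newton's recursion
    [k A_k = sum_j p_j A_(k-j)], which also characterizes [B_k / k!].
    Both identities survive the limit [N -> oo] by absolute convergence. *)

(** * Cauchy products and multiplication by a fractional linear series *)

Section Convolution.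
Context {R : comNzRingType}.
Implicit Types (a b : R) (f g h : nat -> R).

Definition cauchy_prod f g (k : nat) : R := \sum_(i < k.+1) f i * g (k - i)%N.

Lemma cauchy_prodC f g k : cauchy_prod f g k = cauchy_prod g f k.
Proof.
rewrite /cauchy_prod (reindex_inj rev_ord_inj)/=; apply: eq_bigr => i _.
by rewrite subSS mulrC subKn ?leq_ord.
Qed.

(* With [f], [g] read as the power series [f(z)], [g(z)], this says
   [(1 - a z) g'(z) = (1 - b z) g(z)]. *)
Definition mobius a b g g' :=
  g' 0%N = g 0%N /\ forall k, g' k.+1 = a * g' k + g k.+1 - b * g k.

(** Both sides of [(1 - a z) g'(z) = (1 - b z) g(z)] may be multiplied by the series [f(z)]. *)
Lemma mobius_conv a b f g g' :
  mobius a b g g' -> mobius a b (cauchy_prod f g) (cauchy_prod f g').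
Proof.
move=> [g0 gS]; split=> [|k]; first by rewrite /cauchy_prod !big_ord1 g0.
rewrite /cauchy_prod [LHS]big_ord_recr [X in _ + X - _]big_ord_recr/= !subnn g0.
suff -> : \sum_(i < k.+1) f i * g' (k.+1 - i)%N =
    a * (\sum_(i < k.+1) f i * g' (k - i)%N) +
    \sum_(i < k.+1) f i * g (k.+1 - i)%N - b * (\sum_(i < k.+1) f i * g (k - i)%N).
  by ring.
rewrite !mulr_sumr -big_split/= -sumrB.
apply: eq_bigr => i _; rewrite subSn ?leq_ord// gS; ring.
Qed.

(** The hypotheses read [(1 - a z) f' = f] and [g' = (1 - b z) g]; their product is the claim. *)
Lemma mobius_conv2 a b f f' g g' : mobius a 0 f f' -> mobius 0 b g g' ->
  mobius a b (cauchy_prod f g) (cauchy_prod f' g').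
Proof.
move=> [f0 fS] /(mobius_conv f')[e0 eS].
have [d0 dS] := mobius_conv g (conj f0 fS).
have {d0 dS}[d0 dS] : mobius a 0 (cauchy_prod f g) (cauchy_prod f' g).
  by split=> [|k]; rewrite ?(cauchy_prodC f) ?(cauchy_prodC f').
split=> [|[|k]]; first by rewrite e0.
  by rewrite eS dS e0 d0; ring.
by rewrite !eS !dS; ring.
Qed.

Lemma mobius_uniq a b g g1 g2 : mobius a b g g1 -> mobius a b g g2 -> g1 =1 g2.
Proof. by move=> [e0 eS] [d0 dS]; elim=> [|k IH]; rewrite ?e0 ?eS ?dS ?IH. Qed.

Lemma eq_mobius a b f g g' : f =1 g -> mobius a b f g' -> mobius a b g g'.
Proof. by move=> fg [e0 eS]; split=> [|k]; rewrite -?fg ?eS// fg. Qed.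

(* The series [a z / (1 - a z)]. *)
Definition geom a (k : nat) : R := if k is 0%N then 0 else a ^+ k.

Lemma mobius_geom a : mobius a 0 (fun k => a *+ (k == 1)%N) (geom a).
Proof.
by split=> //= -[|k]; rewrite /geom/= ?mulr1n ?mulr0n ?exprS ?expr0; ring.
Qed.

Lemma cauchy_prod_delta1 a g k : cauchy_prod (fun k => a *+ (k == 1)%N) g k.+1 = a * g k.
Proof.
rewrite /cauchy_prod big_ord_recl big_ord_recl/= big1 => [|i _].
  by rewrite /bump subn1 mulr1n mulr0n mul0r addr0 add0r.
by rewrite mul0r.
Qed.

(** With [G = a z / (1 - a z) * g], this is the coefficient of [z^(k+1)] in
    [(1 - a z) G = a z g]. *)
Lemma cauchy_prod_geom a g k : cauchy_prod (geom a) g k.+1 = a * cauchy_prod (geom a) g k + a * g k.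
Proof.
rewrite !(cauchy_prodC (geom a)).
by rewrite (mobius_conv g (mobius_geom a)).2 !(cauchy_prodC g) cauchy_prod_delta1; ring.
Qed.

(* The logarithmic derivative [z d/dz] of [(1 - b z) / (1 - a z)] is
   [a z / (1 - a z) - b z / (1 - b z)]. *)
Lemma mobius_newton a b g g' p :
    mobius a b g g' -> (forall k, k%:R * g k = cauchy_prod p g k) ->
  forall k, k%:R * g' k = cauchy_prod (fun j => p j + (geom a j - geom b j)) g' k.
Proof.
move=> gg' H k.
have -> : cauchy_prod (fun j => p j + (geom a j - geom b j)) g' k =
    cauchy_prod p g' k + (cauchy_prod (geom a) g' k - cauchy_prod (geom b) g' k).
  by rewrite -sumrB -big_split/=; apply: eq_bigr => i _; ring.
elim: k => [|k IH].
  rewrite /cauchy_prod !big_ord1 subnn gg'.1 /= !mul0r subr0 addr0.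
  by have := H 0%N; rewrite mul0r /cauchy_prod big_ord1.
rewrite (mobius_conv p gg').2 cauchy_prod_geom (mobius_conv (geom b) gg').2 cauchy_prod_geom.
rewrite -!H gg'.2 -!natr1.
transitivity (a * (k%:R * g' k) + a * g' k + (k%:R + 1) * g k.+1
  - b * (k%:R * g k) - b * g k); first by ring.
by rewrite IH; ring.
Qed.

End Convolution.

(** * Newton's recursion and complete Bell polynomials *)

Section Bell.
Context {F : numFieldType}.
Implicit Types x p f g : nat -> F.

(** Since [p 0 = 0], the recursion expresses [k * f k] through the values of [f] below [k], and a
    positive [k] is invertible in characteristic zero. *)
Lemma newton_uniq p f g : p 0%N = 0 -> f 0%N = g 0%N ->
    (forall k, k%:R * f k = cauchy_prod p f k) -> (forall k, k%:R * g k = cauchy_prod p g k) ->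
  f =1 g.
Proof.
move=> p0 fg0 Hf Hg; elim/ltn_ind => -[//|k] IH.
apply: (@mulfI _ k.+1%:R); first by rewrite pnatr_eq0.
rewrite Hf Hg /cauchy_prod [LHS]big_ord_recl [RHS]big_ord_recl p0 !mul0r !add0r; apply: eq_bigr => i _.
by rewrite IH// lift0 subSS ltnS leq_subr.
Qed.

(** If [E = exp X] then [z E' = (z X') E], and [p] lists the coefficients
    [j x_j / j! = x_j / (j-1)!] of [z X']. *)
Lemma Bell_newton x p k : p 0%N = 0 -> (forall j, p j.+1 = x j.+1 / j`!%:R) ->
  k%:R * (complete_Bell k x / k`!%:R) =
    cauchy_prod p (fun j => complete_Bell j x / j`!%:R) k.
Proof.
move=> p0 pS; case: k => [|k]; first by rewrite /cauchy_prod big_ord1 p0 !mul0r.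
set X := Bell_exponent x k.+1; set e := exp_trunc k.+1 X.
have [q Xq] : exists q, X = 'X * q.
  exists (\sum_(1 <= l < k.+2) (x l / l`!%:R) *: 'X^(l.-1)).
  rewrite mulr_sumr; apply: eq_big_nat => -[|l]// _.
  by rewrite -scalerAr -exprS.
(* Differentiating the truncated exponential loses its top term. That term is divisible by
   [z^(k+1)], by [Xq], so it does not affect the coefficients up to [z^k] compared below. *)
have de : e^`() = X^`() * (e - k.+1`!%:R^-1 *: X ^+ k.+1).
  rewrite /e /exp_trunc [in RHS]big_ord_recr/= addrK raddf_sum big_ord_recl/= expr0.
  rewrite derivZ derivC scaler0 add0r mulr_sumr. apply: eq_bigr => i _.
  rewrite derivZ deriv_exp /bump leq0n add1n -[_ * _ *+ _]scaler_nat scalerA factS natrM invfM.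
  by rewrite mulrAC mulVf ?mul1r ?pnatr_eq0// scalerAr.
have eE j : (j <= k.+1)%N -> e`_j = complete_Bell j x / j`!%:R.
  exact: complete_BellE.
have := congr1 (fun r : {poly F} => r`_k) de; rewrite coef_deriv eE// mulr_natl => ->.
rewrite coefM /cauchy_prod [RHS]big_ord_recl p0 mul0r add0r; apply: eq_bigr => i _.
have ik : (i < k.+1)%N by [].
rewrite ?lift0 subSS coefB coefZ Xq exprMn coefXnM ifT; last first.
  by rewrite ltnS leq_subr.
rewrite mulr0 subr0 -Xq eE; last by rewrite (leq_trans (leq_subr _ _)).
congr (_ * _); rewrite pS coef_deriv /X /Bell_exponent coef_sum.
rewrite big_add1/= big_mkord (bigD1 i)//= big1 => [|j ji].
  rewrite addr0 coefZ coefXn eqxx mulr1 -[LHS]mulr_natr factS natrM invfM.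
  by rewrite [_^-1 * _]mulrC mulrA divfK// pnatr_eq0.
by rewrite coefZ coefXn eqSS eq_sym val_eqE (negbTE ji) mulr0.
Qed.

End Bell.

(** * Unordered sums as limits along exhausting sequences of finite sets *)

Section UnorderedSum.
Context {R : realType}.
Local Open Scope classical_set_scope.

Lemma partial_sumE (I : choiceType) (f : I -> R) (A : {fset I}) :
  partial_sum f A = \sum_(i <- A) f i.
Proof. by rewrite /partial_sum -(big_seq_fsetE _ A xpredT f). Qed.

Lemma sum_fsetD (I : choiceType) (f : I -> R) (A B : {fset I}) :
  (A `<=` B)%fset ->
  \sum_(i <- B) f i = \sum_(i <- A) f i + \sum_(i <- (B `\` A)%fset) f i.
Proof.
move=> AB; rewrite (big_fsetID _ (mem A))/=; congr (_ + _).
  by apply: eq_fbigl => i; rewrite !inE/= andbC; case: (boolP (i \in A)) => //= /(fsubsetP AB).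
by apply: eq_fbigl => i; rewrite !inE/= andbC.
Qed.

(** The net of partial sums is Cauchy: once [A] brings the absolute sum within [e] of its supremum,
    enlarging [A] changes the sum of [f] by less than [e]. *)
Lemma cvg_partial_sum (I : choiceType) (f : I -> R) (M : R) :
  (forall A : {fset I}, \sum_(i <- A) `|f i| <= M) ->
  partial_sum f @ totally --> sum f.
Proof.
move=> fM; have PF := @totally_filter I.
apply: cauchy_cvg; apply: cauchy_exP => e e0.
pose S := [set \sum_(i <- A) `|f i| | A in [set: {fset I}]].
have supS : has_sup S.
  by split; [exists (\sum_(i <- fset0) `|f i|), fset0|exists M => _ [A _ <-]].
have [_ [A _ <-] HA] := sup_adherent e0 supS.
exists (partial_sum f A), A => // B /= AB.
rewrite /ball/= distrC !partial_sumE (sum_fsetD f AB) addrAC subrr add0r.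
apply: le_lt_trans (ler_norm_sum _ _ _) _.
suff : \sum_(i <- B) `|f i| <= sup S by rewrite (sum_fsetD _ AB) => ?; lra.
by apply: sup_upper_bound => //; exists B.
Qed.

(** The finite index sets listed by [L N] increase and eventually contain any given finite set, so
    the limit along them is the limit along all finite sets. The injection [v] allows [I] to be a
    subtype while the lists hold bare values. *)
Lemma cvg_sum_exhaust (I T : choiceType) (v : I -> T) (L : nat -> seq T)
    (g : T -> R) (M : R) :
    injective v -> (forall N, uniq (L N)) ->
    (forall N l, l \in L N -> exists i, v i = l) ->
    (forall m n, (m <= n)%N -> {subset L m <= L n}) ->
    (forall i, exists N, v i \in L N) ->
    (forall N, \sum_(l <- L N) `|g l| <= M) ->
  \sum_(l <- L N) g l @[N --> \oo] --> sum (fun i => g (v i) : R).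
Proof.
move=> vI uL vL mL Lv gM.
(* A partial inverse of [v], which pulls the lists [L N] back to finite sets [F N] of indices. *)
pose u (l : T) : option I :=
  if pselect (exists i, v i = l) is left h then Some (projT1 (cid h)) else None.
have uv i : u (v i) = Some i.
  rewrite /u; case: pselect => [h|[]]; last by exists i.
  by case: cid => j /= /vI ->.
have vu l i : u l = Some i -> v i = l.
  by rewrite /u; case: pselect => // h; case: cid => j /= vj [<-].
pose F N : {fset I} := seq_fset tt (pmap u (L N)).
have inF N i : (i \in F N) = (v i \in L N).
  rewrite seq_fsetE mem_pmap; apply/mapP/idP => [[l lL /esym/vu ->]//|viL].
  by exists (v i); rewrite ?uv.
have sumF (h : T -> R) N : \sum_(i <- F N) h (v i) = \sum_(l <- L N) h l.
  rewrite -(big_map v xpredT); apply: perm_big; apply: uniq_perm => //.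
    by rewrite map_inj_uniq.
  move=> l; apply/mapP/idP => [[i + ->]|lL]; first by rewrite inF.
  by have [i vi] := vL _ _ lL; exists i; rewrite ?inF ?vi.
have exF (A : {fset I}) : exists N, (A `<=` F N)%fset.
  have [N AN] : exists N, forall i, i \in enum_fset A -> v i \in L N.
    elim: (enum_fset A) => [|i s [N HN]]; first by exists 0%N.
    have [n Hn] := Lv i; exists (maxn n N) => j; rewrite inE => /predU1P[->|/HN].
      exact: mL (leq_maxl _ _) _ Hn.
    exact: mL (leq_maxr _ _) _.
  by exists N; apply/fsubsetP => i /AN; rewrite inF.
have Ftot : F @ \oo --> totally.
  move=> P [A _ AP]; have [N AN] := exF A.
  exists N => // n /= Nn; apply: AP => /=; apply: (fsubset_trans AN).
  by apply/fsubsetP => i; rewrite !inF; exact: mL.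
have -> : (fun N => \sum_(l <- L N) g l) = partial_sum (fun i => g (v i)) \o F.
  by apply/funext => N /=; rewrite partial_sumE sumF.
apply: cvg_comp Ftot _; apply: (@cvg_partial_sum _ _ M).
move=> A; have [N AN] := exF A; apply: le_trans (gM N).
rewrite -(sumF (fun l => `|g l|)) (sum_fsetD _ AN) lerDl.
by apply: sumr_ge0.
Qed.

End UnorderedSum.

(** * Enumeration of bounded decreasing sequences *)

Section DecreasingSequences.
Implicit Types (c : bool) (k m n N : nat).

(* All [N >= l_1 >= ... >= l_k >= 1], with strict inequalities between the
   entries when [c] holds. *)
Fixpoint decr_seqs c k N : seq (seq nat) :=
  if k is k'.+1 then [seq m :: l | m <- iota 1 N, l <- decr_seqs c k' (m - c)]
  else [:: [::]].

Lemma mem_decr_seqs c k N l : (l \in decr_seqs c k N) =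
  [&& size l == k, sorted (fun a b => b + c <= a)%N l, all (leq 1) l
    & all (geq N) l].
Proof.
elim: k N l => [|k IH] N [|a l] //=.
  by apply/negbTE/negP => /allpairsPdep[? [? []]].
have -> : (a :: l \in decr_seqs c k.+1 N) =
    (a \in iota 1 N) && (l \in decr_seqs c k (a - c)).
  apply/allpairsPdep/andP => [[m [l' [mN l'k [-> ->]]]]//|[aN lk]].
  by exists a, l.
rewrite mem_iota IH path_sortedE; last first.
  by move=> y x z yx zy; apply: leq_trans zy (leq_trans (leq_addr _ _) yx).
rewrite eqSS add1n ltnS.
case: (size l == k); rewrite ?andbF//=.
case: (sorted _ l); rewrite ?andbF//=.
case: (boolP (all (leq 1) l)) => [l1|]; rewrite ?andbF//= !andbT.
case: (boolP (1 <= a <= N)%N) => [/andP[a1 aN]|aN]/=; last first.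
  by apply/esym/negbTE; move: aN; apply: contra => /and3P[_ -> /andP[-> _]].
rewrite a1 aN/=.
(* Truncated subtraction is harmless here because every entry [b] is positive. *)
have -> : all (fun b => b + c <= a)%N l = all (geq (a - c)%N) l.
  by apply: eq_in_all => b /(allP l1) b1 /=; lia.
case: (boolP (all (geq (a - c)%N) l)) => //= /allP la; apply/esym/allP => b /la /=.
by lia.
Qed.

Lemma decr_seqs_uniq c k N : uniq (decr_seqs c k N).
Proof.
elim: k N => //= k IH N; apply: allpairs_uniq_dep => [|m _|]; first exact: iota_uniq.
  exact: IH.
by move=> [m l] [n l'] _ _ /= [-> ->].
Qed.

Lemma big_decr_seqs (R : nmodType) (F : seq nat -> R) c k N :
  \sum_(l <- decr_seqs c k.+1 N) F l =
    \sum_(1 <= m < N.+1) \sum_(l <- decr_seqs c k (m - c)) F (m :: l).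
Proof. by rewrite /= big_allpairs_dep /index_iota subn1. Qed.

Lemma big_decr_seqsS (R : nmodType) (F : seq nat -> R) c k N :
  \sum_(l <- decr_seqs c k.+1 N.+1) F l =
    \sum_(l <- decr_seqs c k.+1 N) F l
    + \sum_(l <- decr_seqs c k (N.+1 - c)) F (N.+1 :: l).
Proof. by rewrite !big_decr_seqs big_nat_recr. Qed.

End DecreasingSequences.

(** * Truncated sums and their generating functions *)

Section TruncatedSums.
Context {R : comNzRingType}.
Implicit Types (t y : nat -> R) (k N : nat) (l : seq nat).

Definition decr_sum (c : bool) y N k : R :=
  \sum_(l <- decr_seqs c k N) \prod_(m <- l) y m.

Lemma decr_sum0 c y N : decr_sum c y N 0 = 1.
Proof. by rewrite /decr_sum big_seq1 big_nil. Qed.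

Lemma decr_sumS c y N k : decr_sum c y N.+1 k.+1 =
  decr_sum c y N k.+1 + y N.+1 * decr_sum c y (N.+1 - c) k.
Proof.
rewrite /decr_sum big_decr_seqsS mulr_sumr; congr (_ + _).
by apply: eq_bigr => l _; rewrite big_cons.
Qed.

(** The new value [N.+1] may occur any number of times: a factor [1 / (1 - y z)] with
    [y = y N.+1]. *)
Lemma mobius_weak_sum y N :
  mobius (y N.+1) 0 (decr_sum false y N) (decr_sum false y N.+1).
Proof.
split=> [|k]; rewrite ?decr_sum0// decr_sumS subn0; ring.
Qed.

(** Here [N.+1] occurs at most once: a factor [1 + y z]. *)
Lemma mobius_strict_sum y N :
  mobius 0 (- y N.+1) (decr_sum true y N) (decr_sum true y N.+1).
Proof.
split=> [|k]; rewrite ?decr_sum0// decr_sumS subn1/=; ring.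
Qed.

(** The weight of the interpolated sum, taken position by position instead of value by value, so
    that it is multiplicative when an entry is prepended; see [interp_weightE]. *)
Definition tie_weight t l : R :=
  \prod_(r < (size l).-1)
    if nth 0%N l r == nth 0%N l r.+1 then t (nth 0%N l r.+1) else 1.

Lemma tie_weight_cons t a b l : tie_weight t (a :: b :: l) =
  (if a == b then t b else 1) * tie_weight t (b :: l).
Proof. by rewrite /tie_weight /= big_ord_recl. Qed.

Definition interp_sum t y N k : R :=
  \sum_(l <- decr_seqs false k N) tie_weight t l * \prod_(m <- l) y m.

Lemma interp_sum0 t y N : interp_sum t y N 0 = 1.
Proof. by rewrite /interp_sum big_seq1 big_nil /tie_weight big_ord0 mulr1. Qed.

(* Among the sequences below a leading entry [N.+1], those whose own first
   entry is again [N.+1] acquire the factor [t N.+1]. *)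
Lemma interp_sumS t y N k : interp_sum t y N.+1 k.+1 =
  interp_sum t y N k.+1 + y N.+1 *
    (interp_sum t y N k + t N.+1 * (interp_sum t y N.+1 k - interp_sum t y N k)).
Proof.
rewrite {1}/interp_sum big_decr_seqsS subn0 -/(interp_sum t y N k.+1).
congr (_ + _); case: k => [|k].
  rewrite !interp_sum0 subrr mulr0 addr0 mulr1 big_seq1 big_cons big_nil mulr1.
  by rewrite /tie_weight big_ord0 mul1r.
rewrite [interp_sum t y N.+1 _]big_decr_seqsS subn0 -/(interp_sum t y N k.+1).
rewrite addrAC subrr add0r big_decr_seqsS subn0 mulrDr; congr (_ + _).
  rewrite mulr_sumr big_seq [RHS]big_seq; apply: eq_bigr => -[|b l].
    by rewrite mem_decr_seqs.
  rewrite mem_decr_seqs/= => /and4P[_ _ _ /andP[bN _]].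
  by rewrite tie_weight_cons gtn_eqF// mul1r big_cons; ring.
rewrite !mulr_sumr; apply: eq_bigr => l _.
by rewrite tie_weight_cons eqxx !big_cons; ring.
Qed.

Lemma mobius_interp_sum t y N :
  mobius (t N.+1 * y N.+1) ((t N.+1 - 1) * y N.+1)
    (interp_sum t y N) (interp_sum t y N.+1).
Proof.
split=> [|k]; rewrite ?interp_sum0// interp_sumS; ring.
Qed.

Lemma decr_sum_at0 c y k : decr_sum c y 0 k = (k == 0%N)%:R.
Proof. by case: k => [|k]; rewrite ?decr_sum0// /decr_sum big_nil. Qed.

Lemma interp_sum_at0 t y k : interp_sum t y 0 k = (k == 0%N)%:R.
Proof. by case: k => [|k]; rewrite ?interp_sum0// /interp_sum big_nil. Qed.

(** At [N = 0] both generating functions are 1, and passing to [N.+1] multiplies both by the same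
    factor. *)
Lemma interp_sum_conv t y N : interp_sum t y N =1
  cauchy_prod (decr_sum false (fun m => t m * y m) N)
       (decr_sum true (fun m => (1 - t m) * y m) N).
Proof.
elim: N => [|N IH].
  move=> k; rewrite interp_sum_at0 /cauchy_prod big_ord_recl/= !decr_sum_at0 subn0 mul1r.
  by rewrite big1 ?addr0// => i _; rewrite decr_sum_at0 mul0r.
apply: mobius_uniq (mobius_interp_sum t y N) _.
rewrite (_ : (t N.+1 - 1) * _ = - ((1 - t N.+1) * y N.+1)); last by ring.
apply: eq_mobius (fsym IH) _; apply: mobius_conv2.
  exact: (mobius_weak_sum (fun m => t m * y m)).
exact: (mobius_strict_sum (fun m => (1 - t m) * y m)).
Qed.

(** The coefficients of [z d/dz] of the logarithm of the generating function of [interp_sum t y N],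
    one summand per factor. *)
Definition power_sum t y N j : R := \sum_(1 <= m < N.+1)
  (geom (t m * y m) j - geom ((t m - 1) * y m) j).

Lemma interp_sum_newton t y N k :
  k%:R * interp_sum t y N k = cauchy_prod (power_sum t y N) (interp_sum t y N) k.
Proof.
elim: N k => [|N IH] k.
  rewrite interp_sum_at0 /cauchy_prod big1 => [|i _]; first by case: k => [|k]; rewrite ?mul0r ?mulr0.
  by rewrite /power_sum big_nil mul0r.
rewrite (mobius_newton (mobius_interp_sum t y N) IH); apply: eq_bigr => i _.
by rewrite /power_sum [in RHS]big_nat_recr.
Qed.

End TruncatedSums.

(** * Absolute convergence and passage to the limit *)

Section Convergence.
Context {R : realType}.
Implicit Types (t u : nat -> R) (c : bool) (k N s : nat) (l : seq nat).
Local Open Scope classical_set_scope.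

Lemma sum_inv_exp_le2 s N : (2 <= s)%N ->
  \sum_(1 <= m < N.+1) ((m%:R : R) ^+ s)^-1 <= 2.
Proof.
move=> s2; have invX m : (0 < m)%N -> ((m%:R : R) ^+ s)^-1 <= (m%:R ^+ 2)^-1.
  move=> m0; rewrite lef_pV2 ?posrE ?exprn_gt0 ?ltr0n//.
  by rewrite ler_weXn2l// ler1n.
case: N => [|N]; first by rewrite big_nil.
(* The sharper bound makes the induction telescope: [1 / (a + 1)^2 <= 1 / a - 1 / (a + 1)]. *)
apply: (@le_trans _ _ (2 - N.+1%:R^-1)); last by rewrite gerBl invr_ge0.
elim: N => [|N IH].
  by rewrite big_nat1 expr1n invr1; lra.
rewrite big_nat_recr//=; apply: le_trans (lerD IH (invX N.+2 isT)) _.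
rewrite -addrA lerD2l -subr_ge0 -(natr1 N.+1).
have : 0 < N.+1%:R :> R by []; move: (N.+1%:R) => a a0.
have -> : - (a + 1)^-1 - (- a^-1 + ((a + 1) ^+ 2)^-1) = ((a + 1) ^+ 2 * a)^-1.
  by field; rewrite !gt_eqF// addr_gt0.
by rewrite invr_ge0 mulr_ge0 ?exprn_ge0 ?addr_ge0// ltW.
Qed.

(** Expanding the power gives the sum over all sequences, decreasing or not, with nonnegative
    terms. *)
Lemma decr_sum_le (y : nat -> R) c k N : (forall m, 0 <= y m) ->
  decr_sum c y N k <= (\sum_(1 <= m < N.+1) y m) ^+ k.
Proof.
move=> y0; elim: k N => [|k IH] N; first by rewrite decr_sum0.
rewrite exprS mulr_suml /decr_sum big_decr_seqs big_nat [leRHS]big_nat.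
apply: ler_sum => m /andP[m1 mN].
under [leLHS]eq_bigr => l _ do rewrite big_cons.
rewrite -mulr_sumr ler_wpM2l//; apply: le_trans (IH _) _.
rewrite lerXn2r ?nnegrE ?sumr_ge0//.
rewrite [leRHS](@big_cat_nat _ _ _ (m - c).+1)//=; last first.
  by rewrite ltnS (leq_trans (leq_subr _ _)).
by rewrite lerDl sumr_ge0.
Qed.

(** The truncated absolute sums are at most [(C * 2) ^+ k], whatever [N]. The relation [e] stands
    for [geq] or [gtn], which agree with the one in [mem_decr_seqs] only pointwise. *)
Lemma cvg_decr_sum c (e : rel nat) s k (C : R) (g : seq nat -> R) :
    e =2 (fun a b => b + c <= a)%N -> (2 <= s)%N -> 0 <= C ->
    (forall l, all (leq 1) l -> `|g l| <= \prod_(m <- l) (C / m%:R ^+ s)) ->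
  \sum_(l <- decr_seqs c k N) g l @[N --> \oo] -->
    sum (fun i : {l : k.-tuple nat | sorted e l && all (leq 1) l} =>
      g (val (val i)) : R).
Proof.
move=> eE s2 C0 gC; have sE l := eq_sorted eE l.
apply: (@cvg_sum_exhaust _ _ _ (fun i => val (val i)) _ _ ((C * 2) ^+ k)).
- by move=> i j /val_inj/val_inj.
- exact: decr_seqs_uniq.
- move=> N l; rewrite mem_decr_seqs => /and4P[lk ls l1 _].
  have le : sorted e (Tuple lk) && all (leq 1) (Tuple lk) by rewrite sE ls.
  by exists (exist _ (Tuple lk) le).
- move=> m n mn l; rewrite !mem_decr_seqs => /and4P[-> -> ->] /=.
  by apply: sub_all => a /= am; exact: leq_trans am mn.
(* A sequence is listed as soon as [N] reaches its largest entry. *)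
- move=> [l /= /andP[ls l1]]; exists (\max_(a <- l) a)%N.
  rewrite mem_decr_seqs -sE ls l1 size_tuple eqxx/=.
  by apply/allP => a al; exact: (@leq_bigmax_seq _ (l : seq nat) xpredT id).
move=> N; apply: (@le_trans _ _ (decr_sum c (fun m => C / m%:R ^+ s) N k)).
  rewrite /decr_sum big_seq [leRHS]big_seq; apply: ler_sum => l.
  by rewrite mem_decr_seqs => /and4P[_ _ /gC].
apply: le_trans (decr_sum_le _ _ _ _) _ => [m|].
  by rewrite divr_ge0// exprn_ge0.
rewrite lerXn2r ?nnegrE ?mulr_ge0//.
  by rewrite sumr_ge0// => m _; rewrite divr_ge0// exprn_ge0.
by rewrite -mulr_sumr ler_wpM2l// sum_inv_exp_le2.
Qed.

Lemma cvg_weighted_decr_sum c (e : rel nat) u (C : R) s k :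
    e =2 (fun a b => b + c <= a)%N -> (2 <= s)%N ->
    (forall m, (1 <= m)%N -> `|u m| <= C) ->
  decr_sum c (fun m => u m / m%:R ^+ s) N k @[N --> \oo] -->
    sum (fun l : {l : k.-tuple nat | sorted e l && all (leq 1) l} =>
      (\prod_(r < k) u (tnth (val l) r))
        / \prod_(r < k) (tnth (val l) r)%:R ^+ s : R).
Proof.
move=> eE s2 uC; have C0 : 0 <= C := le_trans (normr_ge0 _) (uC 1%N isT).
pose g l := \prod_(m <- l) (u m / m%:R ^+ s).
rewrite [X in sum X](_ : _ =
    fun i : {l : k.-tuple nat | sorted e l && all (leq 1) l} => g (val (val i)));
  last first.
  by apply/funext => i; rewrite /g big_tuple big_split/= prodfV.
apply: (cvg_decr_sum eE s2 C0) => l /allP l1; rewrite /g normr_prod.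
rewrite big_seq [leRHS]big_seq; apply: ler_prod => m /l1 m1.
rewrite normr_ge0 normrM ler_pM// ?uC//.
by rewrite ger0_norm// invr_ge0 exprn_ge0.
Qed.

Lemma cvg_mzsv_rep u (C : R) s k :
    (2 <= s)%N -> (forall m, (1 <= m)%N -> `|u m| <= C) ->
  decr_sum false (fun m => u m / m%:R ^+ s) N k @[N --> \oo] --> mzsv_rep u s k.
Proof. by apply: cvg_weighted_decr_sum => a b; rewrite addn0. Qed.

Lemma cvg_mzv_rep u (C : R) s k :
    (2 <= s)%N -> (forall m, (1 <= m)%N -> `|u m| <= C) ->
  decr_sum true (fun m => u m / m%:R ^+ s) N k @[N --> \oo] --> mzv_rep u s k.
Proof. by apply: cvg_weighted_decr_sum => a b; rewrite addn1. Qed.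

(** Only values occurring in [l] have nonzero [sigma]. Writing each power as a product over
    positions and exchanging the products leaves, at a tied position, the single value found
    there. *)
Lemma interp_weightE t k (l : k.-tuple nat) : all (leq 1) l ->
  interp_weight t l = tie_weight t l.
Proof.
move=> /allP l1; rewrite /interp_weight /tie_weight.
have inl (r : 'I_k.-1) : nth 0%N l r.+1 \in (l : seq nat).
  by rewrite mem_nth// size_tuple; have := ltn_ord r; lia.
rewrite (@fsbigE _ _ _ _ _ (undup l)) ?undup_uniq//; first last.
- move=> j _; rewrite mem_undup => jl; rewrite /sigma eq_card0 ?expr0// => r.
  by rewrite !inE; apply/negP => /andP[_ /eqP rj]; rewrite -rj inl in jl.
- by move=> j /=; rewrite mem_undup => /l1.
rewrite big_mkcond/= size_tuple.
transitivity (\prod_(j <- undup l) \prod_(r < k.-1)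
   if (nth 0%N l r == nth 0%N l r.+1) && (nth 0%N l r.+1 == j) then t j else 1).
  apply: eq_big_seq => j.
  rewrite mem_undup => /l1 j1; rewrite ifT; last by rewrite inE.
  by rewrite -big_mkcond/= -prodr_const.
rewrite exchange_big/=; apply: eq_bigr => r _.
rewrite (bigD1_seq (nth 0%N l r.+1)) ?undup_uniq ?mem_undup//= eqxx andbT.
rewrite big1 ?mulr1// => j; rewrite eq_sym => /negbTE ->; rewrite andbF //.
Qed.

Lemma norm_tie_weight_le1 t l : (forall m, (1 <= m)%N -> `|t m| <= 1) ->
  all (leq 1) l -> `|tie_weight t l| <= 1.
Proof.
move=> t1 /allP l1; rewrite /tie_weight normr_prod prodr_ile1// => r _.
rewrite normr_ge0; case: ifP => _; last by rewrite normr1 lexx.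
apply: t1; apply: l1; apply: mem_nth.
by rewrite -ltn_predRL.
Qed.

(** The weight has absolute value at most 1, so the domination holds with constant 1. *)
Lemma cvg_interp_mzv t s k :
    (2 <= s)%N -> (forall m, (1 <= m)%N -> `|t m| <= 1) ->
  interp_sum t (fun m => (m%:R ^+ s)^-1) N k @[N --> \oo] -->
    interp_mzv t (nseq_tuple k s).
Proof.
move=> s2 t1; pose g l := tie_weight t l * \prod_(m <- l) (m%:R ^+ s)^-1.
rewrite /interp_mzv [X in sum X](_ : _ =
    fun i : wdecr_index k => g (val (val i))); last first.
  apply/funext => -[l /= /andP[_ l1]]; rewrite /g interp_weightE// big_tuple.
  by rewrite prodfV; congr (_ / _); apply: eq_bigr => r _; rewrite tnth_nseq.
apply: (@cvg_decr_sum false _ s k 1 g) => // [a b|l l1].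
  by rewrite addn0.
under eq_bigr do rewrite mul1r.
have p0 : 0 <= \prod_(m <- l) ((m%:R : R) ^+ s)^-1.
  by apply: prodr_ge0 => m _; rewrite invr_ge0 exprn_ge0.
by rewrite /g normrM (ger0_norm p0) ler_piMl// norm_tie_weight_le1.
Qed.

Lemma cvg_weighted_zeta u (C : R) s :
    (2 <= s)%N -> (forall m, (1 <= m)%N -> `|u m| <= C) ->
  \sum_(1 <= m < N.+1) u m / m%:R ^+ s @[N --> \oo] --> weighted_zeta u s.
Proof.
move=> s2 uC; have C0 : 0 <= C := le_trans (normr_ge0 _) (uC 1%N isT).
rewrite (cvg_shiftS (fun N => \sum_(1 <= m < N) u m / m%:R ^+ s)).
suff : cvgn (fun n => \sum_(1 <= m < n) u m / m%:R ^+ s : R) by [].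
rewrite is_cvg_series_restrict; apply: normed_cvg.
apply: nondecreasing_is_cvgn.
  by apply: nondecreasing_series => m _ _; exact: normr_ge0.
exists (C * 2) => _ [N _ <-]; rewrite /= seriesEnat/=.
case: N => [|N]; first by rewrite big_geq ?mulr_ge0.
(* The series has been restarted at index 0, whose term vanishes because [0^-1 = 0]. *)
rewrite big_ltn// expr0n gtn_eqF ?(ltnW s2)// invr0 mulr0 normr0 add0r.
apply: (@le_trans _ _ (C * \sum_(1 <= m < N.+1) (m%:R ^+ s)^-1)); last first.
  by rewrite ler_wpM2l// sum_inv_exp_le2.
rewrite mulr_sumr !big_nat; apply: ler_sum => m /andP[m1 _].
rewrite normrM ler_pM ?uC// ger0_norm// invr_ge0 exprn_ge0//.
Qed.

Lemma cvg_power_sum t s j : (2 <= s)%N -> (1 <= j)%N ->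
    (forall m, (1 <= m)%N -> `|t m| <= 1) ->
  power_sum t (fun m => (m%:R ^+ s)^-1) N j @[N --> \oo] -->
    weighted_zeta (fun m => t m ^+ j) (j * s)
    - weighted_zeta (fun m => (t m - 1) ^+ j) (j * s).
Proof.
move=> s2 j1 t1; have js2 : (2 <= j * s)%N by rewrite (leq_trans s2)// leq_pmull.
have geomE a m : geom (a * (m%:R ^+ s)^-1) j = a ^+ j / m%:R ^+ (j * s) :> R.
  by case: j j1 {js2} => // j _; rewrite /geom exprMn exprVn -exprM mulnC.
rewrite (_ : (fun N => power_sum _ _ N _) = fun N =>
    \sum_(1 <= m < N.+1) t m ^+ j / m%:R ^+ (j * s)
    - \sum_(1 <= m < N.+1) (t m - 1) ^+ j / m%:R ^+ (j * s)); last first.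
  apply/funext => N; rewrite /power_sum sumrB.
  by congr (_ - _); apply: eq_bigr => m _; exact: geomE.
apply: cvgB.
  apply: (@cvg_weighted_zeta _ 1) => // m m1.
  by rewrite normrX exprn_ile1// t1.
(* The constant comes from [|t m - 1| <= 2]. *)
apply: (@cvg_weighted_zeta _ (2 ^+ j)) => // m m1.
rewrite normrX lerXn2r ?nnegrE//; apply: le_trans (ler_normB _ _) _.
by rewrite normr1; have := t1 m m1; lra.
Qed.

Lemma cvg_cauchy_prod (f g : nat -> nat -> R) (a b : nat -> R) k :
    (forall i, (i <= k)%N -> f N i @[N --> \oo] --> a i) ->
    (forall i, (i <= k)%N -> g N i @[N --> \oo] --> b i) ->
  cauchy_prod (f N) (g N) k @[N --> \oo] --> cauchy_prod a b k.
Proof.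
move=> fa gb; rewrite /cauchy_prod; apply: cvg_big => [|i _]; first exact: add_continuous.
by apply: cvgM; [apply: fa; rewrite leq_ord|apply: gb; rewrite leq_subr].
Qed.

End Convergence.

Unset Implicit Arguments.

Theorem corollary1 (R : realType) (s k : nat) (t : nat -> R)
    (hs : (2 <= s)%N) (ht : forall j : nat, (1 <= j)%N -> -1 <= t j <= 1) :
  interp_mzv t (nseq_tuple k s) =
    \sum_(0 <= l < k.+1) mzsv_rep t s l * mzv_rep (fun j => 1 - t j) s (k - l)
  /\
  interp_mzv t (nseq_tuple k s) =
    k`!%:R^-1 * complete_Bell k (fun j =>
      (j - 1)`!%:R * (weighted_zeta (fun m => t m ^+ j) (j * s)
                      - weighted_zeta (fun m => (t m - 1) ^+ j) (j * s))).
Proof.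
have t1 m : (1 <= m)%N -> `|t m| <= 1 by move=> /ht; rewrite ler_norml.
have t2 m : (1 <= m)%N -> `|1 - t m| <= 2.
  by move=> /ht/andP[? ?]; rewrite ler_norml; apply/andP; split; lra.
have cvgA j := cvg_interp_mzv (k := j) hs t1.
split.
  rewrite big_mkord -/(cauchy_prod (mzsv_rep t s) (mzv_rep _ s) k).
  (* The truncated sums also converge to the right-hand side, by their factorization at each [N]. *)
  apply: cvg_unique (cvgA k) _; first exact: norm_hausdorff.
  rewrite (funext (fun N => interp_sum_conv t _ N k)).
  apply: cvg_cauchy_prod => i _; first exact: cvg_mzsv_rep t1.
  exact: cvg_mzv_rep t2.
set x := fun j : nat => _ * (_ - _); rewrite mulrC.
(* For [j >= 1] the factorials cancel and [p j] is the difference of zeta values, the limit of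
   [power_sum]; at 0 it is set to 0, as [newton_uniq] requires. *)
pose p j : R := if j is 0%N then 0 else x j / j.-1`!%:R.
apply: (newton_uniq (p := p) (f := fun j => interp_mzv t (nseq_tuple j s))
  (g := fun j => complete_Bell j x / j`!%:R)) => // [|j|j].
- apply: cvg_unique (cvgA 0%N) _; first exact: norm_hausdorff.
  rewrite (funext (fun N => interp_sum0 t _ N)).
  rewrite -(complete_BellE x (leqnn 0)) /exp_trunc big_ord1 coefZ expr0 coef1 fact0.
  rewrite invr1 mulr1; exact: cvg_cst.
- have cvgjA : (j%:R * interp_sum t (fun m => (m%:R ^+ s)^-1) N j @[N --> \oo]
      --> j%:R * interp_mzv t (nseq_tuple j s))%classic.
    by apply: cvgM; [exact: cvg_cst|exact: cvgA].
  apply: cvg_unique cvgjA _; first exact: norm_hausdorff.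
  rewrite (funext (fun N => interp_sum_newton t _ N j)).
  (* Newton's recursion passes to the limit coefficientwise. The coefficient of index 0 is handled
     apart: there [geom] is 0 by definition, so [power_sum] is constantly 0. *)
  apply: cvg_cauchy_prod => // -[|i] _; last first.
    rewrite /p /x /= subn1 mulrAC mulfV ?mul1r ?pnatr_eq0 -?lt0n ?fact_gt0//.
    exact: cvg_power_sum.
  rewrite /power_sum; under eq_fun do under eq_bigr do rewrite subrr.
  by under eq_fun do rewrite big1//; exact: cvg_cst.
exact: Bell_newton.
Qed.
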